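(* Let $n \geq 1$, $m \geq 2$, $p \geq 2$ be integers. Let $Y \subseteq \mathbb{C}^n$ be the set of all points $(a_1,\ldots,a_n)$ such that the numbers $a_1^m,\ldots,a_n^m$ take at most $p$ distinct values. Then the ideal of all polynomials in $\mathbb{C}[x_1,\ldots,x_n]$ vanishing on $Y$ equals \[\Big\langle \prod_{i \equiv_{\lambda} j,\ i<j} (x_i^m - x_j^m) \;\Big|\; \lambda \text{ a set partition of } [n] \text{ having a unique non-singleton block, of size } p+1\Big\rangle.\]
   Context: $[n]=\{1,\ldots,n\}$. For a set partition $\lambda$ of $[n]$ into disjoint nonempty blocks, $i \equiv_\lambda j$ means that $i$ and $j$ lie in the same block of $\lambda$; the product runs over all pairs $i<j$ in a common block. The partitions considered consist of one block of size $p+1$ with all other blocks singletons. *)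

(* Defs.v *)
From mathcomp Require Import all_boot all_order all_algebra.
From mathcomp Require Export mpoly complex reals.

Set Implicit Arguments.
Unset Strict Implicit.
Unset Printing Implicit Defensive.

Import GRing.Theory.

Local Open Scope ring_scope.

Definition in_ideal_gen (R : comNzRingType) (S : R -> Prop) (f : R) : Prop :=
  exists (k : nat) (c g : 'I_k -> R),
    (forall i, S (g i)) /\ f = \sum_(i < k) c i * g i.

Definition vanishing_ideal (K : comNzRingType) (n : nat)
    (Y : ('I_n -> K) -> Prop) (f : {mpoly K[n]}) : Prop :=
  forall a : 'I_n -> K, Y a -> f.@[a] = 0.

Definition few_powers (K : comNzRingType) (n m p : nat)
    (a : 'I_n -> K) : Prop :=
  (size (undup [seq a i ^+ m | i : 'I_n]) <= p)%N.

Definition unique_nonsingleton_block (n k : nat)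
    (lambda : {set {set 'I_n}}) : Prop :=
  partition lambda [set: 'I_n] /\
  exists2 B : {set 'I_n}, #|B| = k
    & [set A in lambda | #|A| != 1%N] = [set B].

Definition same_block (n : nat) (lambda : {set {set 'I_n}}) : rel 'I_n :=
  fun i j => [exists B in lambda, (i \in B) && (j \in B)].

Definition block_prod (K : comNzRingType) (n m : nat)
    (lambda : {set {set 'I_n}}) : {mpoly K[n]} :=
  \prod_(i < n) \prod_(j < n | (i < j)%N && same_block lambda i j)
    ('X_i ^+ m - 'X_j ^+ m).

(* Main.v *)
(** The products are a Groebner basis.  For the degree-lexicographic order, the
    Vandermonde product of the [x_i ^ m], [i] in [B], has leading monomial
    [\prod_(i in B) x_i ^ (m #{j in B | j > i})], so every polynomial is congruent,
    modulo the ideal of the products, to an [r] none of whose monomials is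
    divisible by such a leading monomial.  It remains to see that [r = 0] if [r]
    vanishes on [Y].  Choose the values of the variables one after the other,
    starting from the last one, and let [b] be the set of their [m]-th powers.
    In the next variable [t], the slices of [r] whose monomials would allow [b] to
    grow too much have degree less than [m #|b|]; they vanish at the [m #|b|]
    points with [t ^ m] in [b] (if [0] is not in [b]), hence are zero.  So [t ^ m]
    may be added to [b], and the argument continues with fewer variables. *)

Require Import Defs.
From mathcomp Require Import all_boot all_order all_algebra.
From mathcomp Require Import separable cyclotomic.
From mathcomp Require Import mpoly complex reals.

Set Implicit Arguments.
Unset Strict Implicit.
Unset Printing Implicit Defensive.

Import Order.TTheory GRing.Theory Num.Theory.

Local Open Scope ring_scope.

(** * Ideals generated by a set *)

Section IdealGen.
Variables (A : comNzRingType) (S : A -> Prop).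

Lemma in_ideal_gen0 : in_ideal_gen S 0.
Proof.
exists 0%N, (fun=> 0), (fun=> 0); split; first by case.
by rewrite big_ord0.
Qed.

Lemma in_ideal_genD f g :
  in_ideal_gen S f -> in_ideal_gen S g -> in_ideal_gen S (f + g).
Proof.
move=> [k [c [u [Su ->]]]] [l [d [v [Sv ->]]]].
exists (k + l)%N, (fun i => match split i with inl j => c j | inr j => d j end),
  (fun i => match split i with inl j => u j | inr j => v j end).
split=> [i|]; first by case: (split i).
rewrite big_split_ord /=; congr (_ + _); apply: eq_bigr => i _.
  by rewrite -[lshift l i]/(unsplit (inl i)) unsplitK.
by rewrite -[rshift k i]/(unsplit (inr i)) unsplitK.
Qed.

Lemma in_ideal_genMl c g : S g -> in_ideal_gen S (c * g).
Proof. by exists 1%N, (fun=> c), (fun=> g); rewrite big_ord1. Qed.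

End IdealGen.

(** * Points whose [m]-th power is prescribed *)

(** One [m]-th root of [b] is multiplied by the roots of ['X^m - 1], which are distinct because this
    polynomial is separable in characteristic 0. *)
Lemma exists_roots_Xn (K : numClosedFieldType) (m : nat) (b : K) :
  (0 < m)%N -> b != 0 ->
  exists r : seq K, [/\ size r = m, uniq r & forall x, x \in r -> x ^+ m = b].
Proof.
move=> m_gt0 b_neq0.
have [z Dz] := closed_field_poly_normal ('X^m - 1 : {poly K}).
move: Dz; rewrite (monicP (monicXnsubC _ m_gt0)) scale1r => Dz.
have zm1 x : x \in z -> x ^+ m = 1.
  by rewrite -root_prod_XsubC -Dz rootE !hornerE subr_eq0 => /eqP.
have y_m : (m.-root b) ^+ m = b by rewrite rootCK.
have y_neq0 : m.-root b != 0 by rewrite rootC_eq0.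
exists [seq m.-root b * x | x <- z]; split=> [||x].
- rewrite size_map; apply: succn_inj.
  by rewrite -(size_prod_XsubC _ id) -Dz size_XnsubC.
- rewrite map_inj_uniq; last exact: mulfI.
  rewrite -separable_prod_XsubC -Dz separable_Xn_sub_1 //.
  by rewrite pnatr_eq0 -lt0n.
- by case/mapP=> u uz ->; rewrite exprMn y_m zm1 ?mulr1.
Qed.

(** Root sets over different elements of [b] are disjoint, as the [m]-th power recovers the element.
    Since 0 has a single root, it must be excluded. *)
Lemma exists_roots_Xn_seq (K : numClosedFieldType) (m : nat) (b : seq K) :
  (0 < m)%N -> uniq b -> 0 \notin b ->
  exists r : seq K,
    [/\ size r = (m * size b)%N, uniq r & forall x, x \in r -> x ^+ m \in b].
Proof.
move=> m_gt0; elim: b => [|y b IHb] /=; first by exists [::]; rewrite muln0.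
case/andP=> yNb b_uniq; rewrite inE eq_sym negb_or => /andP[y_neq0 b0].
have [r [szr r_uniq rb]] := IHb b_uniq b0.
have [u [szu u_uniq uy]] := exists_roots_Xn m_gt0 y_neq0.
exists (u ++ r); split=> [||x].
- by rewrite size_cat szu szr mulnS.
- rewrite cat_uniq u_uniq r_uniq andbT /=; apply/hasPn => x xr.
  by apply: contra yNb => xu; rewrite -(uy _ xu) rb.
- rewrite mem_cat inE => /orP[/uy->|/rb->]; first by rewrite eqxx.
  by rewrite orbT.
Qed.

(** * Splitting off the last variable *)

Section Slice.
Variables (K : comNzRingType) (n : nat).
Implicit Types (f : {mpoly K[n.+1]}) (M : 'X_{1..n.+1}).

Definition mnm_init M : 'X_{1..n} :=
  [multinom M (widen_ord (leqnSn n) i) | i < n].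

Definition extend_point (a : 'I_n -> K) (t : K) (i : 'I_n.+1) : K :=
  oapp a t (unlift ord_max i).

Definition last_eval f (t : K) : {mpoly K[n]} :=
  \sum_(M <- msupp f) (f@_M * t ^+ M ord_max) *: 'X_[mnm_init M].

(** The coefficient of ['X_[e]] when [f] is read as a polynomial in the first [n] variables over the
    polynomials in the last one. *)
Definition slice f (e : 'X_{1..n}) : {poly K} :=
  \sum_(M <- msupp f | mnm_init M == e) f@_M *: 'X^(M ord_max).

Lemma widen_ord_lift_max (i : 'I_n) :
  widen_ord (leqnSn n) i = lift ord_max i.
Proof. exact/val_inj/esym/lift_max. Qed.

Lemma mnm_init_inj M M' :
  mnm_init M = mnm_init M' -> M ord_max = M' ord_max -> M = M'.
Proof.
move=> eqi eqm; apply/mnmP => i; case: (unliftP ord_max i) => [j|] -> //.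
by have /mnmP/(_ j) := eqi; rewrite !mnmE widen_ord_lift_max.
Qed.

Lemma mcoeff_last_eval f t e : (last_eval f t)@_e = (slice f e).[t].
Proof.
rewrite /last_eval /slice horner_sum raddf_sum /= [RHS]big_mkcond /=.
apply: eq_bigr => M _; rewrite mcoeffZ mcoeffX !hornerE.
by case: eqP => _; rewrite ?mulr1 ?mulr0.
Qed.

Lemma meval_last_eval f t a :
  (last_eval f t).@[a] = f.@[extend_point a t].
Proof.
rewrite /last_eval raddf_sum mevalE /=; apply: eq_bigr => M _.
rewrite mevalZ mevalX big_ord_recr /= {2}/extend_point unlift_none /= mulrAC.
rewrite mulrA; congr (_ * _ * _); apply: eq_bigr => i _.
by rewrite /extend_point mnmE widen_ord_lift_max liftK.
Qed.

Lemma coef_slice f M : (slice f (mnm_init M))`_(M ord_max) = f@_M.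
Proof.
rewrite /slice coef_sum; case: (boolP (M \in msupp f)) => [Mf|MNf].
  rewrite big_mkcond (bigD1_seq M) ?msupp_uniq //= eqxx coefZ coefXn eqxx mulr1.
  rewrite big1 ?addr0 // => M' neM; case: eqP => // eqi.
  rewrite coefZ coefXn; case: eqP => [eqm|]; last by rewrite mulr0.
  by case/eqP: neM; apply: mnm_init_inj.
rewrite memN_msupp_eq0 // big_seq_cond big1 // => M' /andP[M'f /eqP eqi].
rewrite coefZ coefXn; case: eqP => [eqm|]; last by rewrite mulr0.
by case/negP: MNf; rewrite (mnm_init_inj (esym eqi) eqm).
Qed.

Lemma size_slice f e d :
  (forall M, M \in msupp f -> mnm_init M = e -> M ord_max < d)%N ->
  (size (slice f e) <= d)%N.
Proof.
move=> led; rewrite /slice big_seq_cond.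
elim/big_ind: _ => [|P Q szP szQ|M /andP[Mf /eqP eqi]].
- by rewrite size_poly0.
- by rewrite (leq_trans (size_polyD _ _)) // geq_max szP.
- by apply: leq_trans (size_scale_leq _ _) _; rewrite size_polyXn led.
Qed.

End Slice.

(** * Staircase exponents *)

(* For [c = 0]: [e] is divisible by the leading monomial of a Vandermonde product
   on [q] indices.  In general, [c] further indices beyond [n] are taken. *)
Definition staircase (n m q c : nat) (e : 'X_{1..n}) : bool :=
  [exists S : {set 'I_n}, (#|S| == q) &&
    [forall i in S, m * (c + #|[set j in S | (i < j)%N]|) <= e i]%N].

Lemma staircaseP (n m q c : nat) (e : 'X_{1..n}) :
  reflect (exists2 S : {set 'I_n}, #|S| = q &
             forall i, i \in S ->
               (m * (c + #|[set j in S | (i < j)%N]|) <= e i)%N)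
          (staircase m q c e).
Proof.
apply: (iffP existsP) => [[S /andP[/eqP SC /forall_inP Se]]|[S SC Se]].
  by exists S.
by exists S; rewrite SC eqxx; apply/forall_inP.
Qed.

Lemma staircase0 (n m c : nat) (e : 'X_{1..n}) : staircase m 0 c e.
Proof.
by apply/staircaseP; exists set0 => [|i]; rewrite ?cards0 ?inE.
Qed.

Section StaircaseInit.
Variables (n m : nat) (M : 'X_{1..n.+1}).
Let w : 'I_n -> 'I_n.+1 := widen_ord (leqnSn n).

Let w_inj : injective w.
Proof. by move=> i j /(congr1 val) /= /val_inj. Qed.

(** The same index set serves, as the last index is not added to it and the counts do not change. *)
Lemma staircase_init q c :
  staircase m q c (mnm_init M) -> staircase m q c M.
Proof.
case/staircaseP=> S SC Se; apply/staircaseP; exists (w @: S).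
  by rewrite card_imset.
move=> _ /imsetP[i iS ->]; move: (Se i iS); rewrite mnmE -/w.
congr (_ * (_ + _) <= _)%N; rewrite -(card_imset _ w_inj); apply: eq_card => j.
rewrite !inE; apply/imsetP/andP => [[k]|[/imsetP[k kS ->] ik]].
  by rewrite inE => /andP[kS ik] ->; rewrite imset_f.
by exists k; rewrite ?inE ?kS.
Qed.

(** The last index joins the set. It lies above all others, so each of their counts grows by one,
    which makes up for lowering [c.+1] to [c]; nothing lies above it, so its own bound is
    [m * c]. *)
Lemma staircase_initS q c :
  (m * c <= M ord_max)%N ->
  staircase m q c.+1 (mnm_init M) -> staircase m q.+1 c M.
Proof.
move=> le_max /staircaseP[S SC Se]; apply/staircaseP.
have maxNS : ord_max \notin w @: S.
  apply/imsetP => -[i _ /(congr1 val)/= eqi].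
  by have := ltn_ord i; rewrite -eqi ltnn.
exists (ord_max |: (w @: S)); first by rewrite cardsU1 maxNS card_imset // SC.
move=> i; rewrite !inE => /predU1P[->|/imsetP[{}i iS ->]].
  rewrite (_ : [set _ in _ | _] = set0) ?cards0 ?addn0 //.
  by apply/setP => j; rewrite !inE ltnNge -ltnS ltn_ord andbF.
move: (Se i iS); rewrite mnmE -/w addSnnS.
congr (_ * (_ + _) <= _)%N.
rewrite -(card_imset _ w_inj).
rewrite (_ : [set j in _ | _] = ord_max |: (w @: [set j in S | (i < j)%N])).
  rewrite cardsU1 [_ \in w @: _](_ : _ = false) //.
  apply: contraNF maxNS => /imsetP[j]; rewrite inE => /andP[jS _] ->.
  by rewrite imset_f.
apply/setP => j; rewrite !inE; apply/andP/idP.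
  case=> /predU1P[->|]; first by rewrite eqxx.
  by case/imsetP=> k kS -> ik; rewrite imset_f ?orbT // inE kS.
case/predU1P=> [->|/imsetP[k]]; first by rewrite eqxx /= ltn_ord.
by rewrite inE => /andP[kS ik] ->; rewrite imset_f ?orbT.
Qed.

End StaircaseInit.

(** * Vanishing of polynomials without staircase monomials *)

Lemma poly_eq0_nonzero (K : numFieldType) (P : {poly K}) :
  (forall t, t != 0 -> P.[t] = 0) -> P = 0.
Proof.
move=> P0; apply/eqP/negPn/negP => P_neq0.
pose rs : seq K := [seq k.+1%:R | k <- iota 0 (size P)].
have := @max_poly_roots _ P rs P_neq0.
rewrite size_map size_iota ltnn => /(_ _ _)/negP; apply => //.
  by apply/allP => _ /mapP[k _ ->]; rewrite rootE P0 // pnatr_eq0.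
rewrite map_inj_uniq ?iota_uniq // => i j /eqP.
by rewrite eqr_nat => /eqP[].
Qed.

(* [b] collects the [m]-th powers of the variables that have already been
   sliced off. *)
Lemma mpoly_eq0_nonstaircase (K : numClosedFieldType) (m : nat) :
  (0 < m)%N -> forall (n q : nat) (b : seq K) (f : {mpoly K[n]}),
  uniq b -> 0 \notin b ->
  (forall M, M \in msupp f -> ~~ staircase m q (size b) M) ->
  (forall (s : seq K) (a : 'I_n -> K), (size s < q + size b)%N ->
     {subset b <= s} -> (forall i, a i ^+ m \in s) -> f.@[a] = 0) ->
  f = 0.
Proof.
move=> m_gt0; elim=> [|n IHn] [|q] b f b_uniq b0 stf f0.
- apply/mpolyP => M; rewrite mcoeff0 memN_msupp_eq0 //; apply/negP => /stf.
  by rewrite staircase0.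
(* Without variables [f] is a constant; its value is tested with [s := b], which is short enough
   because [q.+1] is positive. *)
- have := f0 b (fun=> 0); rewrite addSn ltnS leq_addl => /(_ isT) f00.
  rewrite [f]nvar0_mpolyC mevalC in f00.
  by rewrite [f]nvar0_mpolyC f00 ?mpolyC0 // => -[].
- apply/mpolyP => M; rewrite mcoeff0 memN_msupp_eq0 //; apply/negP => /stf.
  by rewrite staircase0.
have suppE t e : e \in msupp (last_eval f t) ->
    exists2 M, M \in msupp f & mnm_init M = e.
  rewrite mcoeff_msupp mcoeff_last_eval.
  case: (boolP (has (fun M => mnm_init M == e) (msupp f))) => [/hasP|noM].
    by case=> M Mf /eqP eqi _; exists M.
  by rewrite /slice big_hasC // horner0 eqxx.
(* No new power appears, so the induction hypothesis applies with the same [q.+1] and [b]. *)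
have old t : t ^+ m \in b -> last_eval f t = 0.
  move=> tb; apply: (IHn q.+1 b) => // [e /suppE[M Mf <-]|s a szs bs sa].
    by apply: contra (stf M Mf); apply: staircase_init.
  rewrite meval_last_eval; apply: (f0 s) => // i; rewrite /extend_point.
  by case: (unlift _ _) => [j|] /=; rewrite ?sa ?bs.
have [r [szr r_uniq rb]] := exists_roots_Xn_seq m_gt0 b_uniq b0.
(* An exponent at least [m * size b] in the last variable would make the whole monomial a staircase
   one. So the slice has fewer coefficients than the [m * size b] roots given by [old]. *)
have slice0 e : staircase m q (size b).+1 e -> slice f e = 0.
  move=> st_e; apply/eqP/negPn/negP => nz.
  have := @max_poly_roots _ _ r nz; rewrite szr => /(_ _ r_uniq) lt_size.
  have : (size (slice f e) <= m * size b)%N.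
    apply: size_slice => M Mf eqi; rewrite ltnNge; apply: contra (stf M Mf).
    by move/staircase_initS; apply; rewrite eqi.
  rewrite leqNgt lt_size //; apply/allP => t /rb tb.
  by rewrite rootE -mcoeff_last_eval old // mcoeff0.
(* A new power lengthens [b] and lowers [q.+1] to [q], so the bound on [size s] is the same. The
   value [t = 0] is avoided to keep 0 out of [b]. *)
have new t : t != 0 -> last_eval f t = 0.
  move=> t_neq0; have [/old //|tNb] := boolP (t ^+ m \in b).
  apply: (IHn q (t ^+ m :: b)) => /= [|| e| s a szs bs sa].
  - by rewrite tNb.
  - by rewrite inE eq_sym expf_eq0 negb_or negb_and t_neq0 orbT.
  - rewrite mcoeff_msupp mcoeff_last_eval; apply: contra => /slice0 ->.
    by rewrite horner0.
  - rewrite meval_last_eval; apply: (f0 s) => [|x xb|i].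
    + by rewrite addSnnS.
    + by rewrite bs // inE xb orbT.
    + rewrite /extend_point; case: (unlift _ _) => [j|] /=; first exact: sa.
      by rewrite bs ?mem_head.
apply/mpolyP => M; rewrite mcoeff0 -coef_slice.
rewrite (poly_eq0_nonzero (P := slice _ _)) ?coef0 //.
by move=> t /new ft0; rewrite -mcoeff_last_eval ft0 mcoeff0.
Qed.

(** * Partitions with one non-singleton block *)

Section Blocks.
Variables (n : nat).
Implicit Types (lambda : {set {set 'I_n}}) (B : {set 'I_n}).

(** A block containing two distinct elements is not a singleton, hence is [B]. *)
Lemma same_blockE lambda B (i j : 'I_n) :
  [set A in lambda | #|A| != 1%N] = [set B] -> i != j ->
  same_block lambda i j = (i \in B) && (j \in B).
Proof.
move=> lamB neij; apply/exists_inP/andP => [[A Al /andP[iA jA]]|[iB jB]].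
  have : A \in [set A in lambda | #|A| != 1%N].
    rewrite inE Al /=; apply: contra neij => /cards1P[x defA].
    by move: iA jA; rewrite defA !inE => /eqP-> /eqP->.
  by rewrite lamB => /set1P <-.
have := set11 B; rewrite -lamB inE => /andP[Bl _].
by exists B; rewrite ?iB.
Qed.

Definition vandermonde (K : comNzRingType) (m : nat) B : {mpoly K[n]} :=
  \prod_(i < n) \prod_(j < n | (i < j)%N && ((i \in B) && (j \in B)))
    ('X_i ^+ m - 'X_j ^+ m).

Lemma block_prodE (K : comNzRingType) (m : nat) lambda B :
  [set A in lambda | #|A| != 1%N] = [set B] ->
  block_prod K m lambda = vandermonde K m B.
Proof.
move=> lamB; apply: eq_bigr => i _; apply: eq_bigl => j.
by apply: andb_id2l => ltij; rewrite (same_blockE lamB) // neq_ltn ltij.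
Qed.

(** The other blocks are the singletons of the complement of [B]. *)
Lemma exists_block_partition B :
  (1 < #|B|)%N -> exists lambda, partition lambda [set: 'I_n] /\
    [set A in lambda | #|A| != 1%N] = [set B].
Proof.
move=> B_gt1; exists (B |: [set [set i] | i in ~: B]); split.
  apply/and3P; split.
  - apply/eqP/setP => i; rewrite inE; apply/bigcupP.
    have [iB|iNB] := boolP (i \in B); first by exists B; rewrite ?setU11.
    by exists [set i]; rewrite ?set11 // !inE imset_f ?orbT // inE.
  - apply/trivIsetP => A C; rewrite !inE.
    case/predU1P=> [->|/imsetP[i iNB ->]]; case/predU1P=> [->|/imsetP[j jNB ->]].
    + by rewrite eqxx.
    + by rewrite disjoint_sym disjoints1 -in_setC jNB.
    + by rewrite disjoints1 -in_setC iNB.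
    + by rewrite disjoints1 inE; apply: contra => /eqP->.
  - rewrite !inE negb_or eq_sym -card_gt0 (ltnW B_gt1).
    by apply/imsetP => -[i _ /setP/(_ i)]; rewrite !inE eqxx.
apply/setP => A; rewrite !inE; apply/andP/eqP => [[]|->].
  by case/predU1P=> // /imsetP[i _ ->]; rewrite cards1.
by rewrite eqxx gtn_eqF.
Qed.

End Blocks.

(** * Leading monomials *)

Section Leading.
Variables (K : fieldType) (n : nat).
Implicit Types (f g : {mpoly K[n]}).

(** The leading terms cancel; this decrease makes the division terminate. *)
Lemma mleadB_lt f g :
  mlead g = mlead f -> mleadc g = mleadc f -> f != g ->
  (mlead (f - g) < mlead f)%O.
Proof.
move=> eql eqc neqfg; rewrite lt_neqAle; apply/andP; split.
  apply: contra neqfg => /eqP eqfg; rewrite -subr_eq0 -mleadc_eq0 eqfg.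
  by rewrite mcoeffB -eqc eql subrr.
by apply: le_trans (mleadB_le _ _) _; rewrite eql joinxx.
Qed.

Lemma mlead_XnB (m : nat) (i j : 'I_n) : (0 < m)%N -> (i < j)%N ->
  mlead ('X_i ^+ m - 'X_j ^+ m : {mpoly K[n]}) = (U_(i) *+ m)%MM.
Proof.
move=> m_gt0 ltij; rewrite !mpolyXn mleadDl mleadXm // mleadN mleadXm.
apply/ltmcP; first by rewrite !mdegMn !mdeg1.
exists i => [k ltki|]; rewrite !mulmnE !mnm1E.
  by rewrite -!val_eqE /= gtn_eqF ?(ltn_trans ltki) // gtn_eqF.
by rewrite eqxx -val_eqE /= gtn_eqF // mul1n.
Qed.

Lemma XnB_neq0 (m : nat) (i j : 'I_n) : (0 < m)%N -> (i < j)%N ->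
  ('X_i ^+ m - 'X_j ^+ m : {mpoly K[n]}) != 0.
Proof.
move=> m_gt0 ltij; apply/eqP => /(congr1 (@mlead _ _)).
rewrite mlead_XnB // mlead0 => /mnmP/(_ i).
by rewrite mulmnE mnm1E eqxx mul1n mnm0E => m0; rewrite m0 in m_gt0.
Qed.

Variables (m : nat) (B : {set 'I_n}).
Hypothesis m_gt0 : (0 < m)%N.

Lemma vandermonde_neq0 : vandermonde K m B != 0.
Proof.
apply/prodf_neq0 => i _; apply/prodf_neq0 => j /andP[ltij _].
exact: XnB_neq0.
Qed.

(** Leading monomials multiply, and each pair [i < j] in [B] contributes [x_i ^ m]. So the exponent
    at [k] in [B] is [m] times the number of larger elements of [B], and it is 0 outside [B]. *)
Lemma mlead_vandermonde_le (e : 'X_{1..n}) :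
  (forall i, i \in B -> m * #|[set j in B | (i < j)%N]| <= e i)%N ->
  (mlead (vandermonde K m B) <= e)%MM.
Proof.
move=> Be; apply/mnm_lepP => k.
rewrite /vandermonde mlead_prod => [|i _ _]; last first.
  by apply/prodf_neq0 => j /andP[ltij _]; apply: XnB_neq0.
rewrite mnm_sumE (bigD1 k) //= [X in (_ + X)%N]big1 ?addn0 => [|i neik].
  rewrite mlead_prod => [|j _ /andP[ltkj _]]; last exact: XnB_neq0.
  rewrite mnm_sumE (eq_bigr (fun=> m)) => [|j /andP[ltkj _]]; last first.
    by rewrite mlead_XnB // mulmnE mnm1E eqxx mul1n.
  have [kB|kNB] := boolP (k \in B); last first.
    by rewrite big_pred0 // => j; rewrite andbF.
  rewrite sum_nat_const mulnC; apply: leq_trans (Be k kB).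
  rewrite leq_mul2l; apply/orP; right; apply: subset_leq_card.
  by apply/subsetP => j; rewrite !inE /= andbC.
rewrite mlead_prod => [|j _ /andP[ltij _]]; last exact: XnB_neq0.
rewrite mnm_sumE big1 // => j /andP[ltij _].
by rewrite mlead_XnB // mulmnE mnm1E (negPf neik).
Qed.

End Leading.

(** * Division by the products *)

Definition block_gens (K : comNzRingType) (n m k : nat) (g : {mpoly K[n]}) : Prop :=
  exists lambda : {set {set 'I_n}},
    unique_nonsingleton_block k lambda /\ g = block_prod K m lambda.

(** Induction on the leading monomial: a staircase leading term is cancelled by a multiple of a
    product, any other one is moved to the remainder. *)
Lemma staircase_reduction (K : fieldType) (n m k : nat) (f : {mpoly K[n]}) :
  (0 < m)%N -> (1 < k)%N ->
  exists r : {mpoly K[n]}, in_ideal_gen (@block_gens K n m k) (f - r) /\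
    forall M, M \in msupp r -> ~~ staircase m k 0 M.
Proof.
move=> m_gt0 k_gt1; elim/mleadrect: f => f IHf.
have [->|f_neq0] := eqVneq f 0.
  exists 0; split=> [|M]; first by rewrite subr0; apply: in_ideal_gen0.
  by rewrite msupp0.
have reduce g : mlead g = mlead f -> mleadc g = mleadc f ->
    exists r : {mpoly K[n]}, in_ideal_gen (@block_gens K n m k) (f - g - r) /\
    forall M, M \in msupp r -> ~~ staircase m k 0 M.
  move=> eql eqc; have [<-|nefg] := eqVneq f g; last exact/IHf/mleadB_lt.
  exists 0; split=> [|M]; first by rewrite subrr subr0; apply: in_ideal_gen0.
  by rewrite msupp0.
have c_neq0 : mleadc f != 0 by rewrite mleadc_eq0.
have [/staircaseP[B cardB Be]|Nst] := boolP (staircase m k 0 (mlead f)); last first.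
  have [||r [fr st_r]] := reduce (mleadc f *: 'X_[mlead f]).
  - by rewrite mleadZ ?mleadXm.
  - by rewrite mleadZ // mleadXm mcoeffZ mcoeffX eqxx mulr1.
  exists (r + mleadc f *: 'X_[mlead f]); split; first by rewrite opprD addrA addrAC.
  move=> M /msuppD_le; rewrite mem_cat => /orP[/st_r //|/msuppZ_le].
  by rewrite msuppX inE => /eqP->.
have [|lambda [part_lam lamB]] := @exists_block_partition _ B; first by rewrite cardB.
set V := block_prod K m lambda.
have V_neq0 : V != 0 by rewrite /V (block_prodE _ _ lamB) vandermonde_neq0.
have leV : (mlead V <= mlead f)%MM.
  by rewrite /V (block_prodE _ _ lamB) mlead_vandermonde_le.
have cV_neq0 : mleadc V != 0 by rewrite mleadc_eq0.
pose h : {mpoly K[n]} := (mleadc f / mleadc V) *: 'X_[mlead f - mlead V].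
have hc_neq0 : mleadc f / mleadc V != 0 by rewrite mulf_neq0 ?invr_eq0.
have mlead_h : mlead h = (mlead f - mlead V)%MM by rewrite mleadZ // mleadXm.
have h_neq0 : h != 0 by rewrite -mleadc_eq0 mlead_h mcoeffZ mcoeffX eqxx mulr1.
have eql : mlead (h * V) = mlead f by rewrite mleadM // mlead_h submK.
have [||r [fr st_r]] := reduce (h * V) => //.
  by rewrite mleadM // mleadcM mlead_h mcoeffZ mcoeffX eqxx mulr1 divfK.
exists r; split=> //; rewrite -(subrK (h * V) f) addrAC.
apply: in_ideal_genD fr _; apply: in_ideal_genMl; exists lambda; split=> //.
by split=> //; exists B.
Qed.

(** * The two inclusions *)

(** Pigeonhole: two of the [p.+1] indices in the block have the same [m]-th power, and their factor
    vanishes. *)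
Lemma meval_block_prod_few (K : idomainType) (n m p : nat)
    (lambda : {set {set 'I_n}}) (a : 'I_n -> K) :
  unique_nonsingleton_block p.+1 lambda -> few_powers m p a ->
  (block_prod K m lambda).@[a] = 0.
Proof.
move=> [_ [B cardB lamB]] few_a; rewrite (block_prodE _ _ lamB).
have [i iB [j jB [neij eqa]]] : exists2 i, i \in B & exists2 j, j \in B &
    i != j /\ a i ^+ m = a j ^+ m.
  have /dinjectivePn[i iB [j]] : ~~ dinjectiveb (fun i => a i ^+ m) B.
    rewrite /dinjectiveb; apply/negP => inj.
    have : {subset [seq a i ^+ m | i <- enum B] <= undup [seq a i ^+ m | i : 'I_n]}.
      by move=> _ /mapP[i _ ->]; rewrite mem_undup; apply: map_f; rewrite mem_enum.
    move/(uniq_leq_size inj); rewrite size_map -cardE cardB.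
    by move/leq_trans/(_ few_a); rewrite ltnn.
  by rewrite !inE => /andP[neji jB] eqa; exists i => //; exists j; rewrite // eq_sym.
wlog ltij : i j iB jB neij eqa / (i < j)%N.
  move=> W; move: (neij); rewrite neq_ltn => /orP[/W|/W]; first exact.
  by apply; rewrite // eq_sym.
rewrite /vandermonde rmorph_prod (bigD1 i) //= rmorph_prod (bigD1 j) /=; last by rewrite ltij iB.
by rewrite rmorphB !rmorphXn /= !mevalXU eqa subrr !mul0r.
Qed.

Lemma few_powers_mem (K : comNzRingType) (n m p : nat) (s : seq K) (a : 'I_n -> K) :
  (size s <= p)%N -> (forall i, a i ^+ m \in s) -> few_powers m p a.
Proof.
move=> szs sa; apply: leq_trans szs; apply: uniq_leq_size (undup_uniq _) _.
by move=> x; rewrite mem_undup => /mapP[i _ ->].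
Qed.

Theorem theorem1p4 (R : realType) (n m p : nat)
    (hn : (1 <= n)%N) (hm : (2 <= m)%N) (hp : (2 <= p)%N)
    (f : {mpoly R[i][n]}) :
  vanishing_ideal (@few_powers R[i] n m p) f <->
  in_ideal_gen
    (fun g => exists lambda : {set {set 'I_n}},
       unique_nonsingleton_block p.+1 lambda /\ g = block_prod R[i] m lambda) f.
Proof.
have ideal_vanish g : in_ideal_gen (@block_gens R[i] n m p.+1) g ->
    vanishing_ideal (@few_powers R[i] n m p) g.
  move=> [k [c [u [gen_u ->]]]] a few_a; rewrite rmorph_sum big1 //= => i _.
  have [lambda [lamP ->]] := gen_u i.
  by rewrite rmorphM /= (meval_block_prod_few lamP few_a) mulr0.
split; last exact: ideal_vanish.
move=> f0; have [||r [fr st_r]] := @staircase_reduction _ n m p.+1 f.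
- exact: ltnW.
- exact: ltnW.
suff r0 : r = 0 by move: fr; rewrite r0 subr0.
(* With [b] empty and [q = p.+1], the list [s] has at most [p] elements, so [a] has few powers.
   There both [f] and [f - r] vanish, hence so does [r]. *)
apply: (@mpoly_eq0_nonstaircase _ m (ltnW hm) n p.+1 [::]) => // s a szs _ sa.
have few_a : few_powers m p a by apply: few_powers_mem sa; rewrite addn0 ltnS in szs.
have := ideal_vanish _ fr a few_a; rewrite mevalB f0 // sub0r.
by move/eqP; rewrite oppr_eq0 => /eqP.
Qed.
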